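(* Let the collision term be $\mathcal C(f)=-\phi_0f+\phi_0\frac12\int_{-1}^1f\,d\mu+3\mu\phi_1\frac12\int_{-1}^1f\mu\,d\mu$, with $\tilde\chi\ne0$, $\tilde\chi+\phi_0\ne0$ and $\tilde\chi+\phi_0-\phi_1\neq0$. Let $f=\sum_{i\ge0}\varepsilon^if_i$ be the Hilbert expansion and $\beta=\frac12\int_{-1}^1f\,d\mu$. Then (without assuming Enskog's postulate or the strong Chapman--Enskog hypothesis) the reaction-type equation $$\frac{d\beta}{c\,dt}+\frac13\frac{d\ln\rho}{c\,dt}\,\omega\frac{\partial\beta}{\partial\omega}=j-\tilde\chi\beta$$ is an approximation of the angular mean of Boltzmann's equation $\mathcal D(f)=\varepsilon^{-1}\big(\bar j+\bar{\mathcal J}(f)\big)$ of order $\mathcal O(\varepsilon)$.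
   Context: Variables: time $t$, radius $r>0$, cosine of the propagation angle $\mu\in[-1,1]$, energy $\omega>0$; $f=f(t,r,\mu,\omega)$. The constant $c>0$ is the speed of light; $\rho=\rho(t,r)>0$ and $v=v(t,r)$ are given functions (density and radial velocity of the background matter), and $\frac{d}{dt}:=\frac{\partial}{\partial t}+v\frac{\partial}{\partial r}$. The linear operator $\mathcal D$ is $$\mathcal D(f)=\frac1c\frac{df}{dt}+\mu\frac{\partial f}{\partial r}+F_\mu\frac{\partial f}{\partial\mu}+F_\omega\frac{\partial f}{\partial\omega},$$ $$F_\mu=\frac1r(1-\mu^2)+\mu\Big(\frac{d\ln\rho}{c\,dt}+\frac{3v}{cr}\Big)(1-\mu^2),\qquad F_\omega=\Big[\mu^2\Big(\frac{d\ln\rho}{c\,dt}+\frac{3v}{cr}\Big)-\frac{v}{cr}\Big]\omega .$$ The functions $j\ge0$ (emissivity), $\chi\geq 0$ (absorptivity), $\tilde\chi=j+\chi$, $\phi_0,\phi_1$ depend on $(t,r,\omega)$ but not on $\mu$. Put $\mathcal J(f)=-\tilde\chi f+\mathcal C(f)$. Here $\varepsilon>0$ is a small parameter, $\bar j=\varepsilon j$, $\bar{\tilde\chi}=\varepsilon\tilde\chi$, $\bar\phi_0=\varepsilon\phi_0$, $\bar\phi_1=\varepsilon\phi_1$, $\bar{\mathcal J}=\varepsilon\mathcal J$, and the barred quantities are independent of $\varepsilon$ (so $j,\tilde\chi$ are of order $\varepsilon^{-1}$). Hilbert expansion: $f=\sum_{i\ge0}\varepsilon^if_i$, $\mathcal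 D(f)=\sum_{i\ge0}\varepsilon^i\mathcal D(f_i)$, and the $f_i$ solve the hierarchy $0=j+\mathcal J(f_0)$, $\mathcal D(f_{i-1})=\bar{\mathcal J}(f_i)$, $i=1,2,\dots$. Meaning of the conclusion: the angular mean of Boltzmann's equation is $\frac12\int_{-1}^1\mathcal D(f)\,d\mu=j-\tilde\chi\beta$, and the conclusion states that its left-hand side equals the left-hand side of the reaction-type equation plus $\mathcal O(\varepsilon)$. All series are formal; series, integrals and partial derivatives are assumed to be interchangeable; $\mathcal O(\varepsilon^k)$ denotes, in the formal sense, the neglected part starting with order $\varepsilon^k$ of a formal series in $\varepsilon$. *)

(* Defs.v *)
From Stdlib Require Import Reals ZArith.
From Coquelicot Require Import Coquelicot.
Open Scope R_scope.

(** Functions of (t, r, mu, omega), of (t, r, omega), and of (t, r).  Only the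
    values with r > 0, -1 <= mu <= 1 and omega > 0 are meaningful. *)
Definition field := R -> R -> R -> R -> R.
Definition iso_field := R -> R -> R -> R.
Definition background := R -> R -> R.

Definition d_t (g : field) : field :=
  fun t r mu w => Derive (fun x => g x r mu w) t.
Definition d_r (g : field) : field :=
  fun t r mu w => Derive (fun x => g t x mu w) r.
Definition d_mu (g : field) : field :=
  fun t r mu w => Derive (fun x => g t r x w) mu.
Definition d_omega (g : field) : field :=
  fun t r mu w => Derive (fun x => g t r mu x) w.

(** The partial derivative in mu is only required for -1 < mu < 1; at
    mu = 1 and mu = -1 its coefficient [F_mu] vanishes. *)
Definition regular (g : field) : Prop :=
  forall t r w, 0 < r -> 0 < w ->
    ex_RInt (fun mu => g t r mu w) (-1) 1 /\
    (forall mu, -1 < mu < 1 -> ex_derive (fun x => g t r x w) mu) /\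
    (forall mu, -1 <= mu <= 1 ->
       ex_derive (fun x => g x r mu w) t /\
       ex_derive (fun x => g t x mu w) r /\
       ex_derive (fun x => g t r mu x) w).

Definition mean (g : field) : field :=
  fun t r _ w => / 2 * RInt (fun mu => g t r mu w) (-1) 1.

Definition mean_mu (g : field) : field :=
  fun t r _ w => / 2 * RInt (fun mu => g t r mu w * mu) (-1) 1.

(** df/dt along the matter flow, and (d ln rho)/(c dt). *)
Definition d_flow (v : background) (g : field) : field :=
  fun t r mu w => d_t g t r mu w + v t r * d_r g t r mu w.

Definition dlnrho (c : R) (rho v : background) : background :=
  fun t r => / c * (Derive (fun x => ln (rho x r)) t
                    + v t r * Derive (fun x => ln (rho t x)) r).

Definition F_mu (c : R) (rho v : background) (t r mu : R) : R :=
  / r * (1 - mu ^ 2)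
  + mu * (dlnrho c rho v t r + 3 * v t r / (c * r)) * (1 - mu ^ 2).

Definition F_omega (c : R) (rho v : background) (t r mu w : R) : R :=
  (mu ^ 2 * (dlnrho c rho v t r + 3 * v t r / (c * r)) - v t r / (c * r)) * w.

Definition transport (c : R) (rho v : background) (g : field) : field :=
  fun t r mu w =>
    / c * d_flow v g t r mu w + mu * d_r g t r mu w
    + F_mu c rho v t r mu * d_mu g t r mu w
    + F_omega c rho v t r mu w * d_omega g t r mu w.

Definition reaction (c : R) (rho v : background) (b : field) : field :=
  fun t r mu w =>
    / c * d_flow v b t r mu w
    + / 3 * dlnrho c rho v t r * (w * d_omega b t r mu w).

(** Formal Laurent series in the indeterminate epsilon: [s n] is the
    coefficient of epsilon^n. *)
Definition series := Z -> field.

Definition fzero : field := fun _ _ _ _ => 0.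
Definition szero : series := fun _ => fzero.
Definition sadd (s1 s2 : series) : series :=
  fun n t r mu w => s1 n t r mu w + s2 n t r mu w.
Definition sopp (s : series) : series :=
  fun n t r mu w => - s n t r mu w.
Definition smap (L : field -> field) (s : series) : series :=
  fun n => L (s n).

(** The monomial g epsilon^k. *)
Definition monom (k : Z) (g : field) : series :=
  fun n => if Z.eqb n k then g else fzero.

(** Multiplication by epsilon^k. *)
Definition eps (k : Z) (s : series) : series := fun n => s (n - k)%Z.

Definition of_iso (a : iso_field) : field := fun t r _ w => a t r w.

(** For a barred coefficient [abar], the unbarred one is
    a = epsilon^(-1) abar: as a series, and acting by multiplication. *)
Definition unbar (abar : iso_field) : series := monom (-1) (of_iso abar).
Definition unbar_mul (abar : iso_field) (s : series) : series :=
  eps (-1) (smap (fun g t r mu w => abar t r w * g t r mu w) s).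

Definition times_3mu (s : series) : series :=
  fun n t r mu w => 3 * mu * s n t r mu w.

Definition collision (phi0bar phi1bar : iso_field) (s : series) : series :=
  sadd (sadd (sopp (unbar_mul phi0bar s)) (unbar_mul phi0bar (smap mean s)))
       (times_3mu (unbar_mul phi1bar (smap mean_mu s))).

Definition chi_tilde (jbar chibar : iso_field) : iso_field :=
  fun t r w => jbar t r w + chibar t r w.

Definition Jop (jbar chibar phi0bar phi1bar : iso_field) (s : series) : series :=
  sadd (sopp (unbar_mul (chi_tilde jbar chibar) s))
       (collision phi0bar phi1bar s).

Definition Jbar (jbar chibar phi0bar phi1bar : iso_field) (s : series) : series :=
  eps 1 (Jop jbar chibar phi0bar phi1bar s).

Definition eq_on_domain (g1 g2 : field) : Prop :=
  forall t r mu w, 0 < r -> -1 <= mu <= 1 -> 0 < w ->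
    g1 t r mu w = g2 t r mu w.

Definition series_eq (s1 s2 : series) : Prop :=
  forall n, eq_on_domain (s1 n) (s2 n).

(** s1 = s2 + O(epsilon^k), formally. *)
Definition series_eq_upto (k : Z) (s1 s2 : series) : Prop :=
  forall n, (n < k)%Z -> eq_on_domain (s1 n) (s2 n).

(** The series sum_(i >= 0) epsilon^i f_i. *)
Definition expansion (f : nat -> field) : series :=
  fun n => if Z.ltb n 0 then fzero else f (Z.to_nat n).

Definition hilbert_hierarchy (c : R) (rho v : background)
    (jbar chibar phi0bar phi1bar : iso_field) (f : nat -> field) : Prop :=
  series_eq szero
    (sadd (unbar jbar) (Jop jbar chibar phi0bar phi1bar (monom 0 (f 0%nat)))) /\
  forall i : nat,
    series_eq (smap (transport c rho v) (monom 0 (f i)))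
              (Jbar jbar chibar phi0bar phi1bar (monom 0 (f (S i)))).

(* Main.v *)
(** Integrating the zeroth equation of the hierarchy against 1 and mu shows that
    f_0 has no first angular moment, because chi~ + phi_0 - phi_1 <> 0, and hence
    that f_0 = j / chi~ is isotropic.  For an isotropic field the mu-derivative
    vanishes and the angular mean of mu^2 is 1/3, so the 3v/(cr) and v/(cr)
    terms of F_omega cancel and the mean of D(f_0) is exactly the left-hand side
    of the reaction equation.  Collisions conserve the angular mean, which gives
    the averaged Boltzmann equation at every order. *)
Require Import Defs.
From Stdlib Require Import Reals ZArith Lia Lra.
From Coquelicot Require Import Coquelicot.
Open Scope R_scope.

(** * Angular moments of polynomials in [mu] *)

Lemma is_RInt_quadratic (a b d : R) :
  is_RInt (fun x => a + b * x + d * x ^ 2) (-1) 1 (2 * a + 2 * d / 3).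
Proof.
set (F := fun x => a * x + b * x ^ 2 / 2 + d * x ^ 3 / 3).
replace (2 * a + 2 * d / 3) with (minus (F 1) (F (-1)))
  by (unfold minus, plus, opp, F; simpl; field).
apply (is_RInt_derive (V := R_CompleteNormedModule) F); intros x _.
- unfold F; auto_derive; [easy | field].
- apply (ex_derive_continuous (fun y => a + b * y + d * y ^ 2)); auto_derive; easy.
Qed.

(** The odd term drops out and [mu ^ 2] has mean 1/3. Agreement on the open interval suffices for
    the integral; this matters because [mu]-derivatives are controlled only there. *)
Lemma mean_quadratic (g : field) (t r mu w a b d : R) :
  (forall x, -1 < x < 1 -> g t r x w = a + b * x + d * x ^ 2) ->
  mean g t r mu w = a + d / 3.
Proof.
intros Hg; unfold mean.
rewrite (RInt_ext _ (fun x => a + b * x + d * x ^ 2)).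
- rewrite (is_RInt_unique _ _ _ _ (is_RInt_quadratic a b d)); field.
- intros x; rewrite Rmin_left, Rmax_right by lra; apply Hg.
Qed.

Lemma mean_mu_affine (g : field) (t r mu w a b : R) :
  (forall x, -1 < x < 1 -> g t r x w = a + b * x) ->
  mean_mu g t r mu w = b / 3.
Proof.
intros Hg.
change (mean (fun t r x w => g t r x w * x) t r mu w = b / 3).
rewrite (mean_quadratic _ t r mu w 0 a b); [field |].
intros x Hx; rewrite (Hg x Hx); ring.
Qed.

Lemma mean_fzero t r mu w : mean fzero t r mu w = 0.
Proof.
rewrite (mean_quadratic _ t r mu w 0 0 0); [field | intros; unfold fzero; ring].
Qed.

Lemma mean_mu_fzero t r mu w : mean_mu fzero t r mu w = 0.
Proof.
rewrite (mean_mu_affine _ t r mu w 0 0); [field | intros; unfold fzero; ring].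
Qed.

Lemma transport_fzero c rho v t r mu w : transport c rho v fzero t r mu w = 0.
Proof.
unfold transport, d_flow, d_t, d_r, d_mu, d_omega, fzero.
rewrite !Derive_const; ring.
Qed.

Lemma reaction_mean_fzero c rho v t r mu w :
  reaction c rho v (mean fzero) t r mu w = 0.
Proof.
assert (H0 : forall h : R -> R, (forall x, h x = 0) -> forall x, Derive h x = 0).
{ intros h Hh x; rewrite (Derive_ext h (fun _ => 0) x Hh); apply Derive_const. }
unfold reaction, d_flow, d_t, d_r, d_omega.
rewrite !H0; [ring | intros x; apply mean_fzero ..].
Qed.

(** * The collision operator on single coefficients *)

Definition linear_collision (chit phi0 phi1 : iso_field) (g : field) : field :=
  fun t r mu w =>
    - (chit t r w * g t r mu w)
    + (- (phi0 t r w * g t r mu w) + phi0 t r w * mean g t r mu w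
       + 3 * mu * (phi1 t r w * mean_mu g t r mu w)).

(** Each term of [Jop] carries exactly one factor epsilon^(-1), whence the shift by one. *)
Lemma Jop_coef j chi phi0 phi1 s n t r mu w :
  Jop j chi phi0 phi1 s n t r mu w =
  linear_collision (chi_tilde j chi) phi0 phi1 (s (n + 1)%Z) t r mu w.
Proof. reflexivity. Qed.

Lemma Jbar_coef j chi phi0 phi1 s n t r mu w :
  Jbar j chi phi0 phi1 s n t r mu w =
  linear_collision (chi_tilde j chi) phi0 phi1 (s n) t r mu w.
Proof.
unfold Jbar, eps; rewrite Jop_coef; now replace (n - 1 + 1)%Z with n by lia.
Qed.

Lemma linear_collision_fzero chit phi0 phi1 t r mu w :
  linear_collision chit phi0 phi1 fzero t r mu w = 0.
Proof.
unfold linear_collision; rewrite mean_fzero, mean_mu_fzero; unfold fzero; ring.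
Qed.

(** In the mean the two [phi0] terms cancel, and the [phi1] term is odd in [mu]. *)
Lemma mean_source_linear_collision chit phi0 phi1 (q g : field) t r mu w :
  (forall x, q t r x w = q t r mu w) ->
  ex_RInt (fun x => g t r x w) (-1) 1 ->
  mean (fun t r x w => q t r x w + linear_collision chit phi0 phi1 g t r x w)
    t r mu w
  = q t r mu w - chit t r w * mean g t r mu w.
Proof.
intros Hq Hg.
set (a := q t r mu w + phi0 t r w * mean g t r mu w).
set (b := 3 * phi1 t r w * mean_mu g t r mu w).
set (k := - (chit t r w + phi0 t r w)).
assert (HI : is_RInt
  (fun x => q t r x w + linear_collision chit phi0 phi1 g t r x w) (-1) 1
  (k * RInt (fun x => g t r x w) (-1) 1 + (2 * a + 2 * 0 / 3))).
{ apply (is_RInt_ext (fun x => k * g t r x w + (a + b * x + 0 * x ^ 2))).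
  - intros x _; rewrite Hq; simpl; unfold linear_collision, k, a, b, mean, mean_mu; ring.
  - apply (is_RInt_plus (V := R_NormedModule)
             (fun x => k * g t r x w) (fun x => a + b * x + 0 * x ^ 2)).
    + apply (is_RInt_scal (V := R_NormedModule) (fun x => g t r x w)).
      now apply (RInt_correct (V := R_CompleteNormedModule)).
    + apply is_RInt_quadratic. }
unfold mean at 1; rewrite (is_RInt_unique _ _ _ _ HI).
unfold k, a, mean; field.
Qed.

(** Solved for [g], the equation makes [g] affine in [mu] with coefficients built from its own
    moments; taking the moments of that affine function determines them. *)
Lemma linear_collision_isotropic chit phi0 phi1 (j : iso_field) g t r w :
  chit t r w <> 0 -> chit t r w + phi0 t r w <> 0 ->
  chit t r w + phi0 t r w - phi1 t r w <> 0 ->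
  (forall mu, -1 <= mu <= 1 ->
     0 = j t r w + linear_collision chit phi0 phi1 g t r mu w) ->
  forall mu, -1 <= mu <= 1 -> g t r mu w = j t r w / chit t r w.
Proof.
intros Hc Hc0 Hc01 H.
set (s := chit t r w + phi0 t r w) in *.
(* The argument 0 is a dummy: both moments ignore their [mu] argument. *)
set (m0 := mean g t r 0 w); set (m1 := mean_mu g t r 0 w).
assert (Hg : forall mu, -1 <= mu <= 1 -> g t r mu w =
  (j t r w + phi0 t r w * m0) / s + 3 * phi1 t r w * m1 / s * mu).
{ intros mu Hmu; apply (Rmult_eq_reg_l s); [| exact Hc0].
  generalize (H mu Hmu); unfold linear_collision.
  change (mean g t r mu w) with m0; change (mean_mu g t r mu w) with m1.
  intros E; field_simplify; [| exact Hc0].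
  unfold s; lra. }
(* The first moment of an affine function is a third of its slope, so [s * m1 = phi1 * m1]. *)
assert (Hm1 : m1 = 0).
{ assert (E : m1 = 3 * phi1 t r w * m1 / s / 3).
  { unfold m1 at 1; eapply mean_mu_affine; intros x Hx; apply Hg; lra. }
  apply (Rmult_eq_reg_l (s - phi1 t r w)); [| exact Hc01].
  rewrite Rmult_minus_distr_r; rewrite E at 1; field; exact Hc0. }
assert (Hm0 : chit t r w * m0 = j t r w).
{ assert (E : m0 = (j t r w + phi0 t r w * m0) / s).
  { unfold m0 at 1; rewrite (mean_quadratic g t r 0 w
      ((j t r w + phi0 t r w * m0) / s) 0 0); [field; exact Hc0 |].
    intros x Hx; rewrite Hg, Hm1 by lra; field; exact Hc0. }
  apply (f_equal (fun x => s * x)) in E.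
  replace (s * ((j t r w + phi0 t r w * m0) / s))
    with (j t r w + phi0 t r w * m0) in E by (field; exact Hc0).
  unfold s in E; lra. }
intros mu Hmu; rewrite Hg, Hm1, <- Hm0 by exact Hmu.
unfold s in *; field; split; assumption.
Qed.

(** * Derivatives and transport of isotropic fields *)

Lemma locally_pos (x : R) : 0 < x -> locally x (fun y => 0 < y).
Proof. apply (open_gt 0). Qed.

Lemma d_t_isotropic (b : iso_field) (g : field) t r mu w :
  eq_on_domain g (of_iso b) -> 0 < r -> -1 <= mu <= 1 -> 0 < w ->
  d_t g t r mu w = Derive (fun x => b x r w) t.
Proof. intros g_iso Hr Hmu Hw; apply Derive_ext; intros x; now apply g_iso. Qed.

Lemma d_r_isotropic (b : iso_field) (g : field) t r mu w :
  eq_on_domain g (of_iso b) -> 0 < r -> -1 <= mu <= 1 -> 0 < w ->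
  d_r g t r mu w = Derive (fun x => b t x w) r.
Proof.
intros g_iso Hr Hmu Hw; apply Derive_ext_loc.
apply (filter_imp (fun y => 0 < y)); [| now apply locally_pos].
intros x Hx; now apply g_iso.
Qed.

Lemma d_omega_isotropic (b : iso_field) (g : field) t r mu w :
  eq_on_domain g (of_iso b) -> 0 < r -> -1 <= mu <= 1 -> 0 < w ->
  d_omega g t r mu w = Derive (fun x => b t r x) w.
Proof.
intros g_iso Hr Hmu Hw; apply Derive_ext_loc.
apply (filter_imp (fun y => 0 < y)); [| now apply locally_pos].
intros x Hx; now apply g_iso.
Qed.

(** The domain is closed in [mu], so it contains a neighbourhood of [mu] only at interior points. *)
Lemma d_mu_isotropic (b : iso_field) (g : field) t r mu w :
  eq_on_domain g (of_iso b) -> 0 < r -> -1 < mu < 1 -> 0 < w ->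
  d_mu g t r mu w = 0.
Proof.
intros g_iso Hr Hmu Hw; rewrite <- (Derive_const (b t r w) mu); apply Derive_ext_loc.
apply (filter_imp (fun y => -1 < y /\ y < 1)).
- intros x Hx; apply g_iso; lra.
- apply filter_and; [apply (open_gt (-1)) | apply (open_lt 1)]; apply Hmu.
Qed.

Lemma mean_isotropic (b : iso_field) (g : field) :
  eq_on_domain g (of_iso b) -> eq_on_domain (mean g) (of_iso b).
Proof.
intros g_iso t r mu w Hr _ Hw.
rewrite (mean_quadratic g t r mu w (b t r w) 0 0); [unfold of_iso; field |].
intros x Hx; rewrite g_iso by lra; unfold of_iso; ring.
Qed.

Lemma mean_transport_isotropic c rho v b g :
  0 < c -> eq_on_domain g (of_iso b) ->
  eq_on_domain (mean (transport c rho v g)) (reaction c rho v (mean g)).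
Proof.
intros Hc Hg t r mu w Hr Hmu Hw.
assert (Hm := mean_isotropic b g Hg).
set (bt := Derive (fun x => b x r w) t).
set (br := Derive (fun x => b t x w) r).
set (bw := Derive (fun x => b t r x) w).
(* The arguments are the coefficients of 1, [mu] and [mu ^ 2] in D(g). A third of the last one
   contributes v/(cr), which cancels the -v/(cr) in the first. *)
rewrite (mean_quadratic _ t r mu w
  (/ c * (bt + v t r * br) - v t r / (c * r) * w * bw)
  br
  ((dlnrho c rho v t r + 3 * v t r / (c * r)) * w * bw)).
- unfold reaction, d_flow.
  rewrite (d_t_isotropic b), (d_r_isotropic b), (d_omega_isotropic b) by assumption.
  fold bt br bw; field; lra.
- intros x Hx; unfold transport, d_flow, F_omega.
  rewrite (d_mu_isotropic b), (d_t_isotropic b), (d_r_isotropic b),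
    (d_omega_isotropic b) by (assumption || lra).
  fold bt br bw; ring.
Qed.

Lemma mean_ext_domain g1 g2 :
  eq_on_domain g1 g2 -> eq_on_domain (mean g1) (mean g2).
Proof.
intros H t r mu w Hr _ Hw; unfold mean; f_equal; apply RInt_ext.
intros x; rewrite Rmin_left, Rmax_right by lra; intros Hx; apply H; lra.
Qed.

(** * From the hierarchy to Boltzmann's equation, order by order *)

Lemma expansion_neg f n : (n < 0)%Z -> expansion f n = fzero.
Proof. intros H; unfold expansion; now rewrite (proj2 (Z.ltb_lt n 0) H). Qed.

Lemma expansion_nat f i : expansion f (Z.of_nat i) = f i.
Proof.
unfold expansion; rewrite (proj2 (Z.ltb_ge _ 0)) by lia; now rewrite Nat2Z.id.
Qed.

Lemma hilbert_zeroth c rho v j chi phi0 phi1 f :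
  hilbert_hierarchy c rho v j chi phi0 phi1 f ->
  eq_on_domain fzero (fun t r mu w =>
    j t r w + linear_collision (chi_tilde j chi) phi0 phi1 (f 0%nat) t r mu w).
(* Both j and J carry epsilon^(-1), so the equation sits at exponent -1. *)
Proof. intros [H _]; exact (H (-1)%Z). Qed.

Lemma hilbert_succ c rho v j chi phi0 phi1 f i :
  hilbert_hierarchy c rho v j chi phi0 phi1 f ->
  eq_on_domain (transport c rho v (f i))
    (linear_collision (chi_tilde j chi) phi0 phi1 (f (S i))).
(* Each f_i enters as a monomial of exponent 0, and neither D nor [Jbar] shifts exponents. *)
Proof. intros [_ H]; exact (H i 0%Z). Qed.

(** Both sides vanish for [n < -1]; [n = -1] is the zeroth equation of the hierarchy, and [n >= 0]
    is its equation for f_(n+1). *)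
Lemma hilbert_boltzmann c rho v j chi phi0 phi1 f :
  hilbert_hierarchy c rho v j chi phi0 phi1 f ->
  forall n, eq_on_domain (transport c rho v (expansion f n))
    (fun t r mu w => unbar j n t r mu w
       + linear_collision (chi_tilde j chi) phi0 phi1 (expansion f (n + 1)%Z)
           t r mu w).
Proof.
intros H n t r mu w Hr Hmu Hw; unfold unbar, monom.
destruct (Z_lt_le_dec n 0) as [Hn | Hn].
- rewrite (expansion_neg f n Hn), transport_fzero.
  destruct (Z.eqb_spec n (-1)) as [-> | Hn1].
  + now apply (hilbert_zeroth _ _ _ _ _ _ _ _ H).
  + rewrite expansion_neg, linear_collision_fzero by lia; unfold fzero; ring.
- rewrite (proj2 (Z.eqb_neq n (-1))) by lia.
  rewrite <- (Z2Nat.id n Hn).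
  replace (Z.of_nat (Z.to_nat n) + 1)%Z with (Z.of_nat (S (Z.to_nat n))) by lia.
  rewrite !expansion_nat, (hilbert_succ _ _ _ _ _ _ _ _ _ H) by assumption.
  unfold fzero; ring.
Qed.

Lemma ex_RInt_expansion f n t r w :
  (forall i, regular (f i)) -> 0 < r -> 0 < w ->
  ex_RInt (fun mu => expansion f n t r mu w) (-1) 1.
Proof.
intros Hf Hr Hw; unfold expansion; destruct (Z.ltb n 0).
- apply (ex_RInt_const (V := R_NormedModule) (-1) 1 0).
- now apply Hf.
Qed.

Theorem theorem2p17
  (c : R) (rho v : background)
  (jbar chibar phi0bar phi1bar : iso_field)
  (f : nat -> field)
  (c_pos : 0 < c)
  (rho_pos : forall t r, 0 < r -> 0 < rho t r)
  (rho_diff : forall t r, 0 < r ->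
     ex_derive (fun x => rho x r) t /\ ex_derive (fun x => rho t x) r)
  (j_ge0 : forall t r w, 0 < r -> 0 < w -> 0 <= jbar t r w)
  (chi_ge0 : forall t r w, 0 < r -> 0 < w -> 0 <= chibar t r w)
  (chit_neq0 : forall t r w, 0 < r -> 0 < w ->
     chi_tilde jbar chibar t r w <> 0)
  (chit_phi0_neq0 : forall t r w, 0 < r -> 0 < w ->
     chi_tilde jbar chibar t r w + phi0bar t r w <> 0)
  (chit_phi0_phi1_neq0 : forall t r w, 0 < r -> 0 < w ->
     chi_tilde jbar chibar t r w + phi0bar t r w - phi1bar t r w <> 0)
  (f_regular : forall i, regular (f i))
  (f_hilbert : hilbert_hierarchy c rho v jbar chibar phi0bar phi1bar f) :
  let fs := expansion f in
  let beta := smap mean fs in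
  let Df := smap (transport c rho v) fs in
  series_eq Df
    (eps (-1) (sadd (eps 1 (unbar jbar))
                    (Jbar jbar chibar phi0bar phi1bar fs))) /\
  series_eq (smap mean Df)
    (sadd (unbar jbar) (sopp (unbar_mul (chi_tilde jbar chibar) beta))) /\
  series_eq_upto 1 (smap mean Df) (smap (reaction c rho v) beta).
Proof.
intros fs beta Df.
assert (HB := hilbert_boltzmann c rho v jbar chibar phi0bar phi1bar f f_hilbert).
split; [| split].
- intros n t r mu w Hr Hmu Hw; unfold Df, smap, fs; rewrite HB by assumption.
  unfold eps at 1, sadd at 1; rewrite Jbar_coef; unfold eps.
  replace (n - -1 - 1)%Z with n by lia.
  now replace (n - -1)%Z with (n + 1)%Z by lia.
- intros n t r mu w Hr Hmu Hw; unfold Df, smap, fs.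
  rewrite (mean_ext_domain _ _ (HB n)) by assumption.
  rewrite mean_source_linear_collision.
  + unfold sadd, sopp, unbar_mul, eps, smap, beta, smap, fs.
    now replace (n - -1)%Z with (n + 1)%Z by lia.
  + intros x; unfold unbar, monom; now destruct (Z.eqb n (-1)).
  + now apply ex_RInt_expansion.
(* Below order 1 only the coefficient [n = 0] is nontrivial, and it involves f_0 alone. *)
- intros n Hn t r mu w Hr Hmu Hw; unfold Df, beta, smap, fs.
  destruct (Z_lt_le_dec n 0) as [Hn0 | Hn0].
  + rewrite (expansion_neg f n Hn0), reaction_mean_fzero.
    rewrite (mean_quadratic _ t r mu w 0 0 0); [field |].
    intros x _; rewrite transport_fzero; ring.
  + replace n with (Z.of_nat 0) by lia; rewrite expansion_nat.
    apply (mean_transport_isotropic c rho v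
      (fun t r w => jbar t r w / chi_tilde jbar chibar t r w)); try assumption.
    (* Isotropy of f_0 is needed on the whole domain, since it is differentiated. *)
    clear t r mu w Hr Hmu Hw; intros t r mu w Hr Hmu Hw.
    apply (linear_collision_isotropic (chi_tilde jbar chibar) phi0bar phi1bar);
      auto.
    intros x Hx; now apply (hilbert_zeroth _ _ _ _ _ _ _ _ f_hilbert).
Qed.
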